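(* The finite difference full discretization described in the context preserves the discrete stochastic conformal multi-symplectic conservation law: for every cell $(i,j,k)$ and every $n\in\mathbb{N}$, $$\delta_t^{2\sigma_{i,j,k}}\omega^n_{\bar i,\bar j,\bar k}+\delta_x(\kappa_1)^{n,\sigma_{i,j,k}}_{i,\bar j,\bar k}+\delta_y(\kappa_2)^{n,\sigma_{i,j,k}}_{\bar i,j,\bar k}+\delta_z(\kappa_3)^{n,\sigma_{i,j,k}}_{\bar i,\bar j,k}=0,\qquad\mathbb{P}\text{-a.s.},$$ where $\omega^n_{i,j,k}=\frac12\,du^n_{i,j,k}\wedge F\,du^n_{i,j,k}$ and $(\kappa_s)^{n,\sigma_{i,j,k}}_{i,j,k}=\frac12\,d\big(A_t^{\sigma_{i,j,k}}u^n_{i,j,k}\big)\wedge K_s\,d\big(A_t^{\sigma_{i,j,k}}u^n_{i,j,k}\big)$, $s=1,2,3$, with the same definitions at half-integer indices.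
   Context: $D=(x_L,x_R)\times(y_L,y_R)\times(z_L,z_R)\subset\mathbb{R}^3$ is a cuboid; $\sigma\in W^{1,\infty}(D)$ with $\sigma\ge\sigma_0>0$ for a constant $\sigma_0$; $\lambda_1\in\mathbb{R}$, $\boldsymbol\lambda_2\in\mathbb{R}^3$. Noise: $W_1,W_2$ are independent $Q_1$- resp. $Q_2$-Wiener processes, $W_i(t)=\sum_{k\ge1}\sqrt{\eta_k^{(i)}}q_k\beta_k^{(i)}(t)$, where $\{q_k\}$ is an orthonormal basis of $L^2(D)$, $Q_iq_k=\eta_k^{(i)}q_k$ with $\eta_k^{(i)}\ge0$, and $\beta_k^{(i)}$ are independent Brownian motions. With $t_n=n\Delta t$: $\Delta W_2^n=W_2(t_{n+1})-W_2(t_n)$, and $\Delta\overline W_1^n=\sqrt{\Delta t}\sum_{i\ge1}\zeta_i^{(1),n}Q_1^{1/2}q_i$ with $\zeta_i^{(1),n}=\max(-A_{\Delta t},\min(\xi_i^{(1),n},A_{\Delta t}))$, $\xi_i^{(1),n}=(\beta_i^{(1)}(t_{n+1})-\beta_i^{(1)}(t_n))/\sqrt{\Delta t}$, $A_{\Delta t}=\sqrt{2b|\ln\Delta t|}$, $b\ge4$ fixed. Grid: uniform mesh sizes $\Delta x,\Delta y,\Delta z$, nodes $x_i=x_L+i\Delta x$, $y_j=y_L+j\Delta y$, $z_k=z_L+k\Delta z$; $u^n_{i,j,k}=((\mathbf E^n_{i,j,k})^\top,(\mathbf H^n_{i,j,k})^\top)^\top\in\mathbb{R}^6$ is the grid approximation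 at $(t_n,x_i,y_j,z_k)$; $\sigma_{i,j,k}=\sigma(x_i,y_j,z_k)$; $\bar i=i+\frac12$, $\bar j=j+\frac12$, $\bar k=k+\frac12$. Half-integer spatial indices on $u$ denote midpoint averages of neighbouring values in that direction, e.g. $u_{\bar i,j,k}=\frac12(u_{i,j,k}+u_{i+1,j,k})$. Differences: $\delta_xZ_{i,j,k}=(Z_{i+1,j,k}-Z_{i,j,k})/\Delta x$, and similarly $\delta_y,\delta_z$; when $\delta_x,\delta_y,\delta_z$ act on expressions carrying the parameter $\sigma_{i,j,k}$ (such as $A_t^{\sigma_{i,j,k}}u$ or $(\kappa_s)^{n,\sigma_{i,j,k}}$), that parameter is kept fixed at the value of the given cell. For a scalar $s$: $\delta_t^{s}Z^n=(Z^{n+1}-e^{-s\Delta t}Z^n)/\Delta t$ and $A_t^{s}Z^n=(Z^{n+1}+e^{-s\Delta t}Z^n)/2$. Noise at cell centres: $(\dot{\overline W}_1)^n_{\bar i,\bar j,\bar k}=\Delta\overline W_1^n(x_{\bar i},y_{\bar j},z_{\bar k})/\Delta t$, $(\dot W_2)^n_{\bar i,\bar j,\bar k}=\Delta W_2^n(x_{\bar i},y_{\bar j},z_{\bar k})/\Delta t$. Matrices: $F=\begin{pmatrix}0&I_3\\-I_3&0\end{pmatrix}$, $K_s=\begin{pmatrix}\mathcal D_s&0\\0&\mathcal D_s\end{pmatrix}$, where $\mathcal D_s\in\mathbb{R}^{3\times3}$ is the skew-symmetric matrix of $a\mapsto\mathbf e_s\times a$, i.e. $\mathcal D_1=\begin{pmatrix}0&0&0\\0&0&-1\\0&1&0\end{pmatrix}$,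 $\mathcal D_2=\begin{pmatrix}0&0&1\\0&0&0\\-1&0&0\end{pmatrix}$, $\mathcal D_3=\begin{pmatrix}0&-1&0\\1&0&0\\0&0&0\end{pmatrix}$. Let $S_1(u)=\frac{\lambda_1}{2}(|\mathbf E|^2+|\mathbf H|^2)$ and $S_2(u)=\boldsymbol\lambda_2\cdot\mathbf E-\boldsymbol\lambda_2\cdot\mathbf H$. Finite difference full discretization: for all cells and $n\in\mathbb N$, with $s=\sigma_{i,j,k}$, $$F\,\delta_t^{s}u^n_{\bar i,\bar j,\bar k}+K_1\,\delta_xA_t^{s}u^n_{i,\bar j,\bar k}+K_2\,\delta_yA_t^{s}u^n_{\bar i,j,\bar k}+K_3\,\delta_zA_t^{s}u^n_{\bar i,\bar j,k}=\nabla_uS_1(A_t^{s}u^n_{\bar i,\bar j,\bar k})(\dot{\overline W}_1)^n_{\bar i,\bar j,\bar k}+\nabla_uS_2(A_t^{s}u^n_{\bar i,\bar j,\bar k})(\dot W_2)^n_{\bar i,\bar j,\bar k}.$$ Here $du^n_{i,j,k}$ denotes the exterior differential of $u^n_{i,j,k}$ (as a function of the initial data, for fixed noise realization), so that the $du$'s satisfy the linearization (variational equation) of the scheme; for $\mathbb{R}^6$-valued one-forms $a,b$ and a matrix $B$, $a\wedge Bb=\sum_{p,q}B_{pq}\,a_p\wedge b_q$. *)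

(* Defs.v *)
From HB Require Import structures.
From mathcomp Require Export all_boot all_order all_algebra.
From mathcomp Require Export all_classical all_reals all_analysis ess_sup_inf.

Set Implicit Arguments.
Unset Strict Implicit.
Unset Printing Implicit Defensive.

Export Order.TTheory GRing.Theory Num.Theory.
Export numFieldNormedType.Exports.

#[global] Open Scope classical_set_scope.
#[global] Open Scope ring_scope.

Section Domain.
Context {R : realType}.

Local Notation R3 := (R * R * R)%type.

Definition leb3 :=
  ((@lebesgue_measure R \x @lebesgue_measure R)
     \x @lebesgue_measure R)%E.

Definition cuboid (xL xR yL yR zL zR : R) : set R3 :=
  (`]xL, xR[ `*` `]yL, yR[) `*` `]zL, zR[.

Definition node (xL yL zL dx dy dz : R) (i j k : nat) : R3 :=
  (xL + i%:R * dx, yL + j%:R * dy, zL + k%:R * dz).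

Definition cell_center (xL yL zL dx dy dz : R) (i j k : nat) : R3 :=
  (xL + (i%:R + 2^-1) * dx, yL + (j%:R + 2^-1) * dy, zL + (k%:R + 2^-1) * dz).

Definition basis3 (a : 'I_3) : R3 :=
  ((a == 0)%:R, (a == 1)%:R, (a == 2)%:R).

Definition iter_partial (l : seq 'I_3) (phi : R3 -> R) :=
  foldr (fun a f => (fun x => 'D_(basis3 a) f x)) phi l.

Definition smooth3 (phi : R3 -> R) :=
  forall l : seq 'I_3,
    continuous (iter_partial l phi) /\
    (forall x a, derivable (iter_partial l phi) x (basis3 a)).

(* C_c^oo(D) *)
Definition test_function (D : set R3)
    (phi : R3 -> R) :=
  smooth3 phi /\
  exists K, [/\ compact K, K `<=` D & forall x, ~ K x -> phi x = 0].

Definition Linfty (D : set R3) (f : R3 -> R) :=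
  measurable_fun D f /\
  (ess_sup leb3 (fun x => (`|(f \_ D) x|)%:E) < +oo)%E.

Definition weak_partial (D : set R3) (a : 'I_3)
    (f g : R3 -> R) :=
  forall phi, test_function D phi ->
    \int[leb3]_(x in D) (f x * 'D_(basis3 a) phi x) =
    - \int[leb3]_(x in D) (g x * phi x).

(* W^{1,oo}(D) *)
Definition W1infty (D : set R3) (f : R3 -> R) :=
  Linfty D f /\
  forall a : 'I_3, exists g, Linfty D g /\ weak_partial D a f g.

Definition L2fun (D : set R3) (f : R3 -> R) :=
  measurable_fun D f /\ leb3.-integrable D (fun x => (f x ^+ 2)%:E).

Definition inner2 (D : set R3) (f g : R3 -> R) : R :=
  \int[leb3]_(x in D) (f x * g x).

(* The q k are representatives of an orthonormal (Hilbert) basis of L^2(D). *)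
Definition orthonormal_basis (D : set R3)
    (q : nat -> R3 -> R) :=
  [/\ forall k, L2fun D (q k),
      forall k l, inner2 D (q k) (q l) = (k == l)%:R &
      forall f, L2fun D f ->
        (fun N => \int[leb3]_(x in D)
           (f x - \sum_(k < N) inner2 D f (q k) * q k x) ^+ 2) @ \oo --> (0 : R)].

End Domain.

Section Noise.
Context {d : measure_display} {Omega : measurableType d} {R : realType}.
Variable P : probability Omega R.
Local Notation R3 := (R * R * R)%type.

Definition mutually_independent (I : eqType) (G : I -> set (set Omega)) :=
  forall (l : seq I) (E : I -> set Omega), uniq l ->
    (forall i, i \in l -> G i (E i)) ->
    P (\bigcap_(i in [set` l]) E i) = (\prod_(i <- l) P (E i))%E.

Definition increment_events (B : R -> {RV P >-> R}) (s t : R) :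
    set (set Omega) :=
  [set (fun w => B t w - B s w) @^-1` A | A in measurable].

(* sigma-algebra generated by the whole path of the process *)
Definition process_events (B : R -> {RV P >-> R}) : set (set Omega) :=
  <<s [set E | exists t A, [/\ 0 <= t, measurable A & E = B t @^-1` A]] >>.

(* Standard Brownian motion on [0, +oo[; the values at negative times are
   irrelevant.  The second parameter of [normal_prob] is the standard
   deviation. *)
Definition brownian_motion (B : R -> {RV P >-> R}) :=
  [/\ {ae P, forall w, B 0 w = 0},
      forall s t, 0 <= s -> s < t -> forall A, measurable A ->
        P ((fun w => B t w - B s w) @^-1` A) = normal_prob 0 (Num.sqrt (t - s)) A,
      forall t : nat -> R, 0 <= t 0%N -> {homo t : m n / (m <= n)%N >-> m <= n} ->
        mutually_independent (fun m => increment_events B (t m) (t m.+1)) &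
      {ae P, forall w, {within `[0, +oo[, continuous (fun t => B t w)}}].

Definition independent_brownian_motions (I : eqType)
    (B : I -> R -> {RV P >-> R}) :=
  (forall i, brownian_motion (B i)) /\
  mutually_independent (fun i => process_events (B i)).

(* Q-Wiener process with covariance operator Q q_k = eta_k q_k, nonnegative and
   of trace class, as a random field on D given by its Karhunen-Loeve
   expansion; the pointwise values of the field are needed because the scheme
   evaluates the noise at cell centres. *)
Definition Q_Wiener_process (D : set R3)
    (q : nat -> R3 -> R) (eta : nat -> R)
    (beta : nat -> R -> {RV P >-> R})
    (W : R -> R3 -> Omega -> R) :=
  [/\ forall k, 0 <= eta k,
      cvgn (series eta) &
      forall t x, 0 <= t -> D x ->
        {ae P, forall w,
          series (fun k => Num.sqrt (eta k) * q k x * beta k t w) @ \oo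
            --> W t x w}].

Definition wiener_increment (W : R -> R3 -> Omega -> R)
    (dt : R) (n : nat) (x : R3) (w : Omega) : R :=
  W (n.+1%:R * dt) x w - W (n%:R * dt) x w.

Definition truncation_level (b dt : R) : R := Num.sqrt (2 * b * `|ln dt|).

Definition normalized_increment (beta : R -> {RV P >-> R})
    (dt : R) (n : nat) (w : Omega) : R :=
  (beta (n.+1%:R * dt) w - beta (n%:R * dt) w) / Num.sqrt dt.

Definition truncated_normal (b : R) (beta : R -> {RV P >-> R})
    (dt : R) (n : nat) (w : Omega) : R :=
  Num.max (- truncation_level b dt)
    (Num.min (normalized_increment beta dt n w) (truncation_level b dt)).

(* Q^{1/2} q_k = sqrt(eta_k) q_k *)
Definition truncated_wiener_increment (b : R)
    (q : nat -> R3 -> R) (eta : nat -> R)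
    (beta : nat -> R -> {RV P >-> R})
    (dt : R) (n : nat) (x : R3) (w : Omega) : R :=
  Num.sqrt dt *
  limn (series (fun k =>
    truncated_normal b (beta k) dt n w * (Num.sqrt (eta k) * q k x))).

End Noise.

(* Grid functions Z i j k, and operators on them.  The value space M is an
   arbitrary module: states, functions of the initial data, or two-forms. *)
Section GridOperators.
Context {R : realType} {M : lmodType R}.

Definition grid (T : Type) := nat -> nat -> nat -> T.

Definition midx (Z : grid M) : grid M :=
  fun i j k => 2^-1 *: (Z i j k + Z i.+1 j k).
Definition midy (Z : grid M) : grid M :=
  fun i j k => 2^-1 *: (Z i j k + Z i j.+1 k).
Definition midz (Z : grid M) : grid M :=
  fun i j k => 2^-1 *: (Z i j k + Z i j k.+1).

Definition deltax (dx : R) (Z : grid M) : grid M :=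
  fun i j k => dx^-1 *: (Z i.+1 j k - Z i j k).
Definition deltay (dy : R) (Z : grid M) : grid M :=
  fun i j k => dy^-1 *: (Z i j.+1 k - Z i j k).
Definition deltaz (dz : R) (Z : grid M) : grid M :=
  fun i j k => dz^-1 *: (Z i j k.+1 - Z i j k).

Definition deltat (dt s : R) (Z : nat -> grid M) : nat -> grid M :=
  fun n i j k => dt^-1 *: (Z n.+1 i j k - expR (- s * dt) *: Z n i j k).
Definition avgt (dt s : R) (Z : nat -> grid M) : nat -> grid M :=
  fun n i j k => 2^-1 *: (Z n.+1 i j k + expR (- s * dt) *: Z n i j k).

End GridOperators.

Section Scheme.
Context {R : realType}.

Definition matF : 'M[R]_(3 + 3) := block_mx 0 1%:M (- 1%:M) 0.

Definition mx_of_rows (l : seq (seq R)) : 'M[R]_3 :=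
  \matrix_(p, r) (nth [::] l p)`_r.

Definition D1 := mx_of_rows [:: [:: 0; 0; 0]; [:: 0; 0; -1]; [:: 0; 1; 0]].
Definition D2 := mx_of_rows [:: [:: 0; 0; 1]; [:: 0; 0; 0]; [:: -1; 0; 0]].
Definition D3 := mx_of_rows [:: [:: 0; -1; 0]; [:: 1; 0; 0]; [:: 0; 0; 0]].

Definition K1 : 'M[R]_(3 + 3) := block_mx D1 0 0 D1.
Definition K2 : 'M[R]_(3 + 3) := block_mx D2 0 0 D2.
Definition K3 : 'M[R]_(3 + 3) := block_mx D3 0 0 D3.

(* A state is u = (E, H), with E = usubmx u and H = dsubmx u. *)
Definition dot3 (a b : 'cV[R]_3) : R := \sum_p a p 0 * b p 0.

Definition S1 (lambda1 : R) (u : 'cV[R]_(3 + 3)) : R :=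
  lambda1 / 2 * (dot3 (usubmx u) (usubmx u) + dot3 (dsubmx u) (dsubmx u)).
Definition S2 (lambda2 : 'cV[R]_3) (u : 'cV[R]_(3 + 3)) : R :=
  dot3 lambda2 (usubmx u) - dot3 lambda2 (dsubmx u).

Definition grad (S : 'cV[R]_(3 + 3) -> R) (u : 'cV[R]_(3 + 3)) :
    'cV[R]_(3 + 3) :=
  \col_p 'D_(delta_mx p 0) S u.

(* The equation of the scheme in cell (i, j, k) at step n, for damping value s
   and cell-centre values w1, w2 of the discretized noises. *)
Definition scheme_equation (dt dx dy dz lambda1 : R) (lambda2 : 'cV[R]_3)
    (s w1 w2 : R) (u : nat -> grid 'cV[R]_(3 + 3)) (n i j k : nat) : Prop :=
  let uc := fun m => midx (midy (midz (u m))) in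
  matF *m deltat dt s uc n i j k
  + K1 *m deltax dx (avgt dt s (fun m => midy (midz (u m))) n) i j k
  + K2 *m deltay dy (avgt dt s (fun m => midx (midz (u m))) n) i j k
  + K3 *m deltaz dz (avgt dt s (fun m => midx (midy (u m))) n) i j k
  = w1 *: grad (S1 lambda1) (avgt dt s uc n i j k)
    + w2 *: grad (S2 lambda2) (avgt dt s uc n i j k).

End Scheme.

(* Differential forms on a space V of initial data (all grid data, or
   coordinates on those admissible for some boundary condition): a one-form
   with values in R^6 is a map (base point, tangent vector) -> R^6, a two-form is a map
   (base point, tangent vector, tangent vector) -> R. *)
Section Forms.
Context {R : realType} {V : normedModType R}.

Definition form1 := V -> V -> 'cV[R]_(3 + 3).
Definition form2 := V -> V -> V -> R.

Definition dext (Z : V -> 'cV[R]_(3 + 3)) : form1 := fun theta v => 'd Z theta v.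

(* a /\ B b = \sum_(p, r) B_pr a_p /\ b_r *)
Definition wedge (a : form1) (B : 'M[R]_(3 + 3)) (b : form1) : form2 :=
  fun theta v1 v2 => \sum_p \sum_r B p r *
    (a theta v1 p 0 * b theta v2 r 0 - a theta v2 p 0 * b theta v1 r 0).

Definition half_wedge (B : 'M[R]_(3 + 3)) (Z : grid (V -> 'cV[R]_(3 + 3))) :
    grid (V -> V -> V -> R) :=
  fun i j k => 2^-1 *: wedge (dext (Z i j k)) B (dext (Z i j k)).

Definition omega (Z : grid (V -> 'cV[R]_(3 + 3))) := half_wedge matF Z.

Definition kappa (K : 'M[R]_(3 + 3)) (dt s : R)
    (Z : nat -> grid (V -> 'cV[R]_(3 + 3))) (n : nat) :=
  half_wedge K (avgt dt s Z n).

Definition conformal_multisymplectic_law (dt dx dy dz s : R)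
    (u : nat -> grid (V -> 'cV[R]_(3 + 3))) (n i j k : nat) : Prop :=
  deltat dt (2 * s) (fun m => omega (midx (midy (midz (u m))))) n i j k
  + deltax dx (kappa K1 dt s (fun m => midy (midz (u m))) n) i j k
  + deltay dy (kappa K2 dt s (fun m => midx (midz (u m))) n) i j k
  + deltaz dz (kappa K3 dt s (fun m => midx (midy (u m))) n) i j k
  = 0.

End Forms.

(* Main.v *)
Require Import Defs.
From mathcomp Require Import ring.

Set Implicit Arguments.
Unset Strict Implicit.
Unset Printing Implicit Defensive.

(* Every matrix B among F, K1, K2, K3 is antisymmetric, so the two-form
   (1/2) dZ /\ B dZ evaluated at (v1, v2) is the bilinear form b_B(d1, d2),
   d_l := dZ(v_l).  With e = exp(- s dt), the products b_B(p1, p2) - b_B(q1, q2)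
   (q being e times the old value in the time direction) are polarized as half of
   b_B(p1 + q1, p2 - q2) - b_B(p2 + q2, p1 - q1).  The average p + q is the same
   in all four terms, namely A_t du at the cell centre, so their sum is
   b_1(A1, L du2) - b_1(A2, L du1) with L the linear left-hand side of the scheme.
   Since grad S1 is lambda1 times the identity and grad S2 is constant, L du is a
   multiple of A, and the difference vanishes. *)

(** * Gradients of the noise Hamiltonians *)

Section Gradients.
Context {R : realType}.
Implicit Types (u : 'cV[R]_(3 + 3)) (p : 'I_(3 + 3)).

(** For [h != 0] the difference quotient is exactly [a + h * c]. Along a coordinate line [S1] is
    quadratic and [S2] affine, so this yields both gradients. *)
Lemma derive_quadratic (W : normedModType R) (f : W -> R) (x v : W) (a c : R) :
  (forall h, f (h *: v + x) = f x + h * a + h ^+ 2 * c) -> 'D_v f x = a.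
Proof.
move=> fE; rewrite /derive; apply: cvg_lim => //.
have : (fun h : R => a + h * c) @ 0^' --> a + 0 * c.
  apply: cvg_within_filter; apply: cvgD; first exact: cvg_cst.
  by apply: cvgM; [exact: cvg_id|exact: cvg_cst].
rewrite mul0r addr0; apply: cvg_trans; apply: near_eq_cvg; near=> h.
have h0 : h != 0 by near: h; exact: nbhs_dnbhs_neq.
by rewrite /= fE /GRing.scale /=; field.
Unshelve. all: by end_near. Qed.

Lemma S1E (lambda1 : R) u : S1 lambda1 u = lambda1 / 2 * \sum_p u p 0 ^+ 2.
Proof.
rewrite /S1 /dot3 big_split_ord /=; congr (_ * (_ + _));
  by apply: eq_bigr => p _; rewrite !mxE expr2.
Qed.

Lemma grad_S1 (lambda1 : R) u : grad (S1 lambda1) u = lambda1 *: u.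
Proof.
apply/colP => p; rewrite !mxE.
apply: (@derive_quadratic _ _ _ _ _ (lambda1 / 2)) => h; rewrite !S1E.
rewrite (bigD1 p) //= [in RHS](bigD1 p) //= !mxE !eqxx mulr1.
under eq_bigr => r rp do rewrite !mxE (negbTE rp) mulr0 add0r.
by field.
Qed.

(** [S2] is linear, so its derivative in a given direction does not depend on the base point. Only
    this constancy matters, since the term is later differentiated away. *)
Lemma grad_S2_const (lambda2 : 'cV[R]_3) u :
  grad (S2 lambda2) u = grad (S2 lambda2) 0.
Proof.
have S2D (h : R) v w : S2 lambda2 (h *: v + w) = S2 lambda2 w + h * S2 lambda2 v.
  rewrite /S2 /dot3 mulrBr !mulr_sumr -!sumrB -big_split /=.
  by apply: eq_bigr => r _; rewrite !mxE; ring.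
apply/colP => p; rewrite !mxE.
transitivity (S2 lambda2 (delta_mx p 0)); [|symmetry];
  by apply: (@derive_quadratic _ _ _ _ _ 0) => h; rewrite mulr0 [RHS]addr0; exact: S2D.
Qed.

End Gradients.

(** * The linear part of the scheme and its cell average *)

Section SchemeOperator.
Context {R : realType}.
Variables (dt dx dy dz s : R).
Local Notation state := 'cV[R]_(3 + 3).
Implicit Types (u : nat -> grid state).

(** The left-hand side of the scheme, isolated because, being linear, it acts in the same way on the
    solution and on its differentials. *)
Definition scheme_operator u (n i j k : nat) : state :=
  matF *m deltat dt s (fun m => midx (midy (midz (u m)))) n i j k
  + K1 *m deltax dx (avgt dt s (fun m => midy (midz (u m))) n) i j k
  + K2 *m deltay dy (avgt dt s (fun m => midx (midz (u m))) n) i j k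
  + K3 *m deltaz dz (avgt dt s (fun m => midx (midy (u m))) n) i j k.

Definition cell_average u (n i j k : nat) : state :=
  avgt dt s (fun m => midx (midy (midz (u m)))) n i j k.

(** Time and space averages commute. The upper face comes first, matching [p + q] in
    [bform_polarization]. *)
Lemma avgt_midx u n i j k :
  let Z := avgt dt s (fun m => midy (midz (u m))) n in
  2^-1 *: (Z i.+1 j k + Z i j k) = cell_average u n i j k.
Proof.
by apply/colP => p /=; rewrite !mxE; move: (expR _) 2^-1 => e h; ring.
Qed.

Lemma avgt_midy u n i j k :
  let Z := avgt dt s (fun m => midx (midz (u m))) n in
  2^-1 *: (Z i j.+1 k + Z i j k) = cell_average u n i j k.
Proof.
by apply/colP => p /=; rewrite !mxE; move: (expR _) 2^-1 => e h; ring.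
Qed.

Lemma avgt_midz u n i j k :
  let Z := avgt dt s (fun m => midx (midy (u m))) n in
  2^-1 *: (Z i j k.+1 + Z i j k) = cell_average u n i j k.
Proof.
by apply/colP => p /=; rewrite !mxE; move: (expR _) 2^-1 => e h; ring.
Qed.

End SchemeOperator.

(** * Antisymmetric bilinear forms and polarization *)

Section BilinearForm.
Context {R : realType}.
Local Notation state := 'cV[R]_(3 + 3).
Implicit Types (B : 'M[R]_(3 + 3)) (a b c p q : state).

Definition bform B a b : R := (a^T *m B *m b) 0 0.

Lemma bformE B a b : bform B a b = \sum_p \sum_r B p r * (a p 0 * b r 0).
Proof.
rewrite /bform mxE exchange_big /=; apply: eq_bigr => r _.
by rewrite mxE mulr_suml; apply: eq_bigr => p _; rewrite !mxE; ring.
Qed.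

Lemma bformDl B a b c : bform B (a + b) c = bform B a c + bform B b c.
Proof. by rewrite /bform linearD /= !mulmxDl mxE. Qed.

Lemma bformDr B a b c : bform B c (a + b) = bform B c a + bform B c b.
Proof. by rewrite /bform mulmxDr mxE. Qed.

Lemma bformZl B (x : R) a b : bform B (x *: a) b = x * bform B a b.
Proof. by rewrite /bform linearZ /= -!scalemxAl mxE. Qed.

Lemma bformZr B (x : R) a b : bform B a (x *: b) = x * bform B a b.
Proof. by rewrite /bform -scalemxAr mxE. Qed.

Lemma bformNr B a b : bform B a (- b) = - bform B a b.
Proof. by rewrite -scaleN1r bformZr mulN1r. Qed.

Lemma bform_mulmx B a b : bform 1%:M a (B *m b) = bform B a b.
Proof. by rewrite /bform mulmx1 mulmxA. Qed.

Lemma bform_antisym B a b : B^T = - B -> bform B b a = - bform B a b.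
Proof.
move=> BT; have -> : bform B b a = (b^T *m B *m a)^T 0 0 by rewrite mxE.
by rewrite !trmx_mul trmxK BT mulNmx mulmxN mulmxA mxE.
Qed.

Lemma bform1C a b : bform 1%:M a b = bform 1%:M b a.
Proof.
by rewrite /bform !mulmx1 -[in LHS](trmxK (_ *m _)) trmx_mul trmxK mxE.
Qed.

(** A discrete product rule: on expanding the right-hand side, antisymmetry cancels the mixed terms
    in p and q and doubles the pure ones. *)
Lemma bform_polarization B p1 p2 q1 q2 (h : R) : B^T = - B ->
  h^-1 * (bform B p1 p2 - bform B q1 q2) =
    bform B (2^-1 *: (p1 + q1)) (h^-1 *: (p2 - q2))
    - bform B (2^-1 *: (p2 + q2)) (h^-1 *: (p1 - q1)).
Proof.
move=> BT; rewrite !(bformZl, bformZr, bformDl, bformDr, bformNr).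
rewrite (bform_antisym p1 p2 BT) (bform_antisym q1 q2 BT).
rewrite (bform_antisym p1 q2 BT) (bform_antisym q1 p2 BT).
(* [h^-1] is a common factor of both sides, so it can be a free variable and no case [h = 0]
   arises. *)
move: h^-1 => h'; by field.
Qed.

Lemma matF_antisym : (@matF R)^T = - matF.
Proof.
by rewrite /matF tr_block_mx opp_block_mx !raddfN /= trmx0 trmx1 opprK oppr0.
Qed.

Lemma block_diag_antisym (D : 'M[R]_3) :
  D^T = - D -> (block_mx D 0 0 D)^T = - block_mx D 0 0 D.
Proof. by move=> DT; rewrite tr_block_mx opp_block_mx !trmx0 !oppr0 DT. Qed.

Lemma K1_antisym : (@K1 R)^T = - K1.
Proof.
apply/block_diag_antisym/matrixP => -[[|[|[|//]]] ?] [[|[|[|//]]] ?];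
  by rewrite !mxE /= ?oppr0 ?opprK.
Qed.

Lemma K2_antisym : (@K2 R)^T = - K2.
Proof.
apply/block_diag_antisym/matrixP => -[[|[|[|//]]] ?] [[|[|[|//]]] ?];
  by rewrite !mxE /= ?oppr0 ?opprK.
Qed.

Lemma K3_antisym : (@K3 R)^T = - K3.
Proof.
apply/block_diag_antisym/matrixP => -[[|[|[|//]]] ?] [[|[|[|//]]] ?];
  by rewrite !mxE /= ?oppr0 ?opprK.
Qed.

End BilinearForm.

(** * The conservation law for a pair of solutions of the linearized scheme *)

Section CellLaw.
Context {R : realType}.
Variables (dt dx dy dz s mu : R).
Local Notation state := 'cV[R]_(3 + 3).

Let grid_bform (B : 'M[R]_(3 + 3)) (y1 y2 : grid state) : grid R^o :=
  fun i j k => bform B (y1 i j k) (y2 i j k).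

(** Here [y1] and [y2] stand for the variations along two tangent vectors. Sharing the same [mu] is
    what makes the two pairings cancel. *)
Lemma scheme_operator_cell_law (y1 y2 : nat -> grid state) (n i j k : nat) :
  scheme_operator dt dx dy dz s y1 n i j k = mu *: cell_average dt s y1 n i j k ->
  scheme_operator dt dx dy dz s y2 n i j k = mu *: cell_average dt s y2 n i j k ->
  deltat dt (2 * s) (fun m => grid_bform matF (midx (midy (midz (y1 m))))
                                              (midx (midy (midz (y2 m))))) n i j k
  + deltax dx (grid_bform K1 (avgt dt s (fun m => midy (midz (y1 m))) n)
                             (avgt dt s (fun m => midy (midz (y2 m))) n)) i j k
  + deltay dy (grid_bform K2 (avgt dt s (fun m => midx (midz (y1 m))) n)
                             (avgt dt s (fun m => midx (midz (y2 m))) n)) i j k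
  + deltaz dz (grid_bform K3 (avgt dt s (fun m => midx (midy (y1 m))) n)
                             (avgt dt s (fun m => midx (midy (y2 m))) n)) i j k
  = 0.
Proof.
move=> E1 E2.
set A1 := cell_average dt s y1 n i j k in E1 *.
set A2 := cell_average dt s y2 n i j k in E2 *.
transitivity (bform 1%:M A1 (scheme_operator dt dx dy dz s y2 n i j k)
            - bform 1%:M A2 (scheme_operator dt dx dy dz s y1 n i j k)); last first.
  (* Both pairings become [mu] times the Euclidean product of [A1] and [A2], which is symmetric. *)
  by rewrite E1 E2; move: (A1) (A2) => a1 a2; rewrite !bformZr (bform1C a2) subrr.
have distr (a x y z t : state) : bform 1%:M a (matF *m x + K1 *m y + K2 *m z + K3 *m t) =
    bform matF a x + bform K1 a y + bform K2 a z + bform K3 a t.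
  by rewrite !bformDr !bform_mulmx.
rewrite /scheme_operator !distr.
have -> : deltat dt (2 * s) (fun m => grid_bform matF (midx (midy (midz (y1 m))))
      (midx (midy (midz (y2 m))))) n i j k =
    bform matF A1 (deltat dt s (fun m => midx (midy (midz (y2 m)))) n i j k)
    - bform matF A2 (deltat dt s (fun m => midx (midy (midz (y1 m)))) n i j k).
  (* The old value carries the factor exp(- s dt) in each argument of the form; their product exp(-
     2 s dt) is the damping of [deltat dt (2 * s)]. *)
  rewrite -(bform_polarization _ _ _ _ _ (@matF_antisym R))
    (bformZl _ (expR _)) (bformZr _ (expR _)) mulrA -expRD.
  by rewrite -mulrDl -opprD -mulr2n -(mulr_natl s 2).
have -> : deltax dx (grid_bform K1 (avgt dt s (fun m => midy (midz (y1 m))) n)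
      (avgt dt s (fun m => midy (midz (y2 m))) n)) i j k =
    bform K1 A1 (deltax dx (avgt dt s (fun m => midy (midz (y2 m))) n) i j k)
    - bform K1 A2 (deltax dx (avgt dt s (fun m => midy (midz (y1 m))) n) i j k).
  (* In space, p and q are the upper and lower faces, whose mean is the cell average. *)
  by rewrite /A1 /A2 -!avgt_midx -(bform_polarization _ _ _ _ _ (@K1_antisym R)).
have -> : deltay dy (grid_bform K2 (avgt dt s (fun m => midx (midz (y1 m))) n)
      (avgt dt s (fun m => midx (midz (y2 m))) n)) i j k =
    bform K2 A1 (deltay dy (avgt dt s (fun m => midx (midz (y2 m))) n) i j k)
    - bform K2 A2 (deltay dy (avgt dt s (fun m => midx (midz (y1 m))) n) i j k).
  by rewrite /A1 /A2 -!avgt_midy -(bform_polarization _ _ _ _ _ (@K2_antisym R)).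
have -> : deltaz dz (grid_bform K3 (avgt dt s (fun m => midx (midy (y1 m))) n)
      (avgt dt s (fun m => midx (midy (y2 m))) n)) i j k =
    bform K3 A1 (deltaz dz (avgt dt s (fun m => midx (midy (y2 m))) n) i j k)
    - bform K3 A2 (deltaz dz (avgt dt s (fun m => midx (midy (y1 m))) n) i j k).
  by rewrite /A1 /A2 -!avgt_midz -(bform_polarization _ _ _ _ _ (@K3_antisym R)).
rewrite !opprD [RHS]addrACA; congr (_ + _).
by rewrite [RHS]addrACA; congr (_ + _); rewrite [RHS]addrACA.
Qed.

End CellLaw.

(** * Differentiation of the scheme in the initial data *)

Section Linearization.
Context {R : realType} {V : normedModType R}.
Local Notation state := 'cV[R]_(3 + 3).

Lemma continuous_mulmx m n (M : 'M[R]_(m, n)) :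
  continuous (mulmx M : 'cV[R]_n -> 'cV[R]_m).
Proof.
(* As a combination of the columns of [M] weighted by coordinates, the map is a finite sum of
   differentiable ones. *)
have -> : (mulmx M : 'cV[R]_n -> 'cV[R]_m) =
    \sum_(r < n) (fun v : 'cV[R]_n => v r 0 *: col r M).
  apply/funext => v; rewrite fct_sumE; apply/colP => p; rewrite !mxE summxE.
  by apply: eq_bigr => r _; rewrite !mxE mulrC.
move=> v; apply: differentiable_continuous; apply: differentiable_sum => r.
exact/differentiableZl/differentiable_coord.
Qed.

Lemma is_diff_mulmx m n (M : 'M[R]_(m, n)) (f df : V -> 'cV[R]_n) theta :
  is_diff theta f df ->
  is_diff theta (fun x => M *m f x) (fun v => M *m df v).
Proof.
move=> dfx; have dM : is_diff (f theta) (mulmx M) (mulmx M).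
  apply: DiffDef; first exact/linear_differentiable/continuous_mulmx.
  exact/diff_lin/continuous_mulmx.
exact: is_diff_comp.
Qed.

Variables (dt dx dy dz s : R) (theta : V).
Variables (u du : nat -> grid (V -> state)) (n i j k : nat).

Lemma is_diff_midx (Z dZ : grid (V -> state)) i' j' k' :
  is_diff theta (Z i' j' k') (dZ i' j' k') ->
  is_diff theta (Z i'.+1 j' k') (dZ i'.+1 j' k') ->
  is_diff theta (midx Z i' j' k') (midx dZ i' j' k').
Proof. by move=> dZ0 dZ1; exact: (is_diffZ 2^-1 (is_diffD dZ0 dZ1)). Qed.

Lemma is_diff_midy (Z dZ : grid (V -> state)) i' j' k' :
  is_diff theta (Z i' j' k') (dZ i' j' k') ->
  is_diff theta (Z i' j'.+1 k') (dZ i' j'.+1 k') ->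
  is_diff theta (midy Z i' j' k') (midy dZ i' j' k').
Proof. by move=> dZ0 dZ1; exact: (is_diffZ 2^-1 (is_diffD dZ0 dZ1)). Qed.

Lemma is_diff_midz (Z dZ : grid (V -> state)) i' j' k' :
  is_diff theta (Z i' j' k') (dZ i' j' k') ->
  is_diff theta (Z i' j' k'.+1) (dZ i' j' k'.+1) ->
  is_diff theta (midz Z i' j' k') (midz dZ i' j' k').
Proof. by move=> dZ0 dZ1; exact: (is_diffZ 2^-1 (is_diffD dZ0 dZ1)). Qed.

Lemma is_diff_avgt (Z dZ : nat -> grid (V -> state)) m i' j' k' :
  is_diff theta (Z m i' j' k') (dZ m i' j' k') ->
  is_diff theta (Z m.+1 i' j' k') (dZ m.+1 i' j' k') ->
  is_diff theta (avgt dt s Z m i' j' k') (avgt dt s dZ m i' j' k').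
Proof.
by move=> dZ0 dZ1;
  exact: (is_diffZ 2^-1 (is_diffD dZ1 (is_diffZ (expR (- s * dt)) dZ0))).
Qed.

(** Booleans serve as offsets 0 and 1, giving the sixteen space-time corners that the cell equation
    reads. *)
Hypothesis du_corner : forall (t a b c : bool),
  is_diff theta (u (t + n)%N (a + i)%N (b + j)%N (c + k)%N)
                (du (t + n)%N (a + i)%N (b + j)%N (c + k)%N).

Lemma is_diff_center (t : bool) :
  is_diff theta (midx (midy (midz (u (t + n)%N))) i j k)
                (midx (midy (midz (du (t + n)%N))) i j k).
Proof.
exact: (is_diff_midx
  (is_diff_midy
    (is_diff_midz
      (du_corner t false false false)
      (du_corner t false false true))
    (is_diff_midz
      (du_corner t false true false)
      (du_corner t false true true)))
  (is_diff_midy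
    (is_diff_midz
      (du_corner t true false false)
      (du_corner t true false true))
    (is_diff_midz
      (du_corner t true true false)
      (du_corner t true true true)))).
Qed.

Lemma is_diff_facex (a : bool) :
  is_diff theta (avgt dt s (fun m => midy (midz (u m))) n (a + i)%N j k)
                (avgt dt s (fun m => midy (midz (du m))) n (a + i)%N j k).
Proof.
exact: (is_diff_avgt
  (is_diff_midy
    (is_diff_midz
      (du_corner false a false false)
      (du_corner false a false true))
    (is_diff_midz
      (du_corner false a true false)
      (du_corner false a true true)))
  (is_diff_midy
    (is_diff_midz
      (du_corner true a false false)
      (du_corner true a false true))
    (is_diff_midz
      (du_corner true a true false)
      (du_corner true a true true)))).
Qed.

Lemma is_diff_facey (b : bool) :
  is_diff theta (avgt dt s (fun m => midx (midz (u m))) n i (b + j)%N k)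
                (avgt dt s (fun m => midx (midz (du m))) n i (b + j)%N k).
Proof.
exact: (is_diff_avgt
  (is_diff_midx
    (is_diff_midz
      (du_corner false false b false)
      (du_corner false false b true))
    (is_diff_midz
      (du_corner false true b false)
      (du_corner false true b true)))
  (is_diff_midx
    (is_diff_midz
      (du_corner true false b false)
      (du_corner true false b true))
    (is_diff_midz
      (du_corner true true b false)
      (du_corner true true b true)))).
Qed.

Lemma is_diff_facez (c : bool) :
  is_diff theta (avgt dt s (fun m => midx (midy (u m))) n i j (c + k)%N)
                (avgt dt s (fun m => midx (midy (du m))) n i j (c + k)%N).
Proof.
exact: (is_diff_avgt
  (is_diff_midx
    (is_diff_midy
      (du_corner false false false c)
      (du_corner false false true c))
    (is_diff_midy
      (du_corner false true false c)
      (du_corner false true true c)))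
  (is_diff_midx
    (is_diff_midy
      (du_corner true false false c)
      (du_corner true false true c))
    (is_diff_midy
      (du_corner true true false c)
      (du_corner true true true c)))).
Qed.

Lemma is_diff_cell_average :
  is_diff theta (fun x => cell_average dt s (fun m a b c => u m a b c x) n i j k)
                (fun v => cell_average dt s (fun m a b c => du m a b c v) n i j k).
Proof.
exact: (@is_diff_avgt (fun m => midx (midy (midz (u m))))
  (fun m => midx (midy (midz (du m)))) _ _ _ _
  (is_diff_center false) (is_diff_center true)).
Qed.

Lemma is_diff_scheme_operator :
  is_diff theta
    (fun x => scheme_operator dt dx dy dz s (fun m a b c => u m a b c x) n i j k)
    (fun v => scheme_operator dt dx dy dz s (fun m a b c => du m a b c v) n i j k).
Proof.
have dT : is_diff theta (deltat dt s (fun m => midx (midy (midz (u m)))) n i j k)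
                        (deltat dt s (fun m => midx (midy (midz (du m)))) n i j k).
  have [d0 d1] := (is_diff_center false, is_diff_center true).
  exact: (is_diffZ dt^-1 (is_diffB d1 (is_diffZ (expR (- s * dt)) d0))).
have dX : is_diff theta
    (deltax dx (avgt dt s (fun m => midy (midz (u m))) n) i j k)
    (deltax dx (avgt dt s (fun m => midy (midz (du m))) n) i j k).
  exact: (is_diffZ dx^-1 (is_diffB (is_diff_facex true) (is_diff_facex false))).
have dY : is_diff theta
    (deltay dy (avgt dt s (fun m => midx (midz (u m))) n) i j k)
    (deltay dy (avgt dt s (fun m => midx (midz (du m))) n) i j k).
  exact: (is_diffZ dy^-1 (is_diffB (is_diff_facey true) (is_diff_facey false))).
have dZ : is_diff theta
    (deltaz dz (avgt dt s (fun m => midx (midy (u m))) n) i j k)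
    (deltaz dz (avgt dt s (fun m => midx (midy (du m))) n) i j k).
  exact: (is_diffZ dz^-1 (is_diffB (is_diff_facez true) (is_diff_facez false))).
have MD := is_diff_mulmx.
exact: (is_diffD (is_diffD (is_diffD (MD _ _ matF _ _ _ dT) (MD _ _ K1 _ _ _ dX))
  (MD _ _ K2 _ _ _ dY)) (MD _ _ K3 _ _ _ dZ)).
Qed.

(** The variational equation: the scheme holds for all initial data with fixed [w1] and [w2], so it
    may be differentiated. The [S1] term is linear in the average and the [S2] term is constant. *)
Lemma linearized_scheme (lambda1 : R) (lambda2 : 'cV[R]_3) (w1 w2 : R) :
  (forall x, scheme_equation dt dx dy dz lambda1 lambda2 s w1 w2
     (fun m a b c => u m a b c x) n i j k) ->
  forall v, scheme_operator dt dx dy dz s (fun m a b c => du m a b c v) n i j k =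
    (w1 * lambda1) *: cell_average dt s (fun m a b c => du m a b c v) n i j k.
Proof.
move=> scheme v.
have schemeE : (fun x => scheme_operator dt dx dy dz s
      (fun m a b c => u m a b c x) n i j k) =
    (w1 * lambda1) *: (fun x => cell_average dt s (fun m a b c => u m a b c x) n i j k)
    + cst (w2 *: grad (S2 lambda2) 0).
  apply/funext => x; have := scheme x; rewrite /scheme_equation /=.
  by rewrite grad_S1 grad_S2_const scalerA.
have dL := is_diff_scheme_operator.
have dA := is_diffZ (w1 * lambda1) is_diff_cell_average.
have dR := is_diffD dA (is_diff_cst (w2 *: grad (S2 lambda2) 0) theta).
have dE : ('d (fun x => scheme_operator dt dx dy dz s (fun m a b c => u m a b c x)
    n i j k) theta : V -> state) = _ :=
  etrans (congr1 (fun f : V -> state => 'd f theta : V -> state) schemeE)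
         (@diff_val _ _ _ _ _ _ _ dR).
rewrite (@diff_val _ _ _ _ _ _ _ dL) in dE.
apply: (etrans (congr1 (@^~ v) dE)); exact: addr0.
Qed.

(** Antisymmetrizing an already antisymmetric form doubles it, which absorbs the factor 1/2. *)
Lemma half_wedgeE (B : 'M[R]_(3 + 3)) (Z : grid (V -> state)) (D : V -> state)
    i' j' k' v1 v2 : B^T = - B -> is_diff theta (Z i' j' k') D ->
  half_wedge B Z i' j' k' theta v1 v2 = bform B (D v1) (D v2).
Proof.
move=> BT dZ.
transitivity (2^-1 * (bform B (D v1) (D v2) - bform B (D v2) (D v1))); last first.
  by rewrite (bform_antisym (D v1) (D v2) BT); field.
rewrite !bformE -sumrB; congr (_ * _); apply: eq_bigr => p _.
by rewrite -sumrB; apply: eq_bigr => r _; rewrite /dext diff_val mulrBr.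
Qed.

Lemma conformal_law_at (mu : R) (v1 v2 : V) :
  (forall v, scheme_operator dt dx dy dz s (fun m a b c => du m a b c v) n i j k =
    mu *: cell_average dt s (fun m a b c => du m a b c v) n i j k) ->
  (deltat dt (2 * s) (fun m => omega (midx (midy (midz (u m))))) n i j k
   + deltax dx (kappa K1 dt s (fun m => midy (midz (u m))) n) i j k
   + deltay dy (kappa K2 dt s (fun m => midx (midz (u m))) n) i j k
   + deltaz dz (kappa K3 dt s (fun m => midx (midy (u m))) n) i j k) theta v1 v2 = 0.
Proof.
move=> lin.
rewrite -(scheme_operator_cell_law (lin v1) (lin v2)).
have W1 := half_wedgeE v1 v2 (@K1_antisym R).
have W2 := half_wedgeE v1 v2 (@K2_antisym R).
have W3 := half_wedgeE v1 v2 (@K3_antisym R).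
have WF := half_wedgeE v1 v2 (@matF_antisym R).
(* The operators act pointwise on forms, so it suffices to match the eight two-forms: two times,
   then two faces per direction. *)
congr (_ *: (_ - _ *: _) + _ *: (_ - _) + _ *: (_ - _) + _ *: (_ - _)).
- exact: WF (is_diff_center true).
- exact: WF (is_diff_center false).
- exact: W1 (is_diff_facex true).
- exact: W1 (is_diff_facex false).
- exact: W2 (is_diff_facey true).
- exact: W2 (is_diff_facey false).
- exact: W3 (is_diff_facez true).
- exact: W3 (is_diff_facez false).
Qed.

End Linearization.

(** * The almost sure conservation law *)

Theorem theorem4p10 (R : realType)
  (xL xR yL yR zL zR : R) (hx : xL < xR) (hy : yL < yR) (hz : zL < zR)
  (sigma : (R * R * R)%type -> R) (sigma0 : R) (hsigma0 : 0 < sigma0)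
  (hsigma : W1infty (cuboid xL xR yL yR zL zR) sigma)
  (* point values of sigma are those of its continuous representative *)
  (hsigmac : {within closure (cuboid xL xR yL yR zL zR), continuous sigma})
  (hsigma_lb : forall x, cuboid xL xR yL yR zL zR x -> sigma0 <= sigma x)
  (lambda1 : R) (lambda2 : 'cV[R]_3)
  (* mesh with Nx * Ny * Nz cells *)
  (Nx Ny Nz : nat) (dt dx dy dz : R) (hdt : 0 < dt)
  (hdx : Nx%:R * dx = xR - xL)
  (hdy : Ny%:R * dy = yR - yL)
  (hdz : Nz%:R * dz = zR - zL)
  (d : measure_display) (Omega : measurableType d) (P : probability Omega R)
  (q : nat -> (R * R * R)%type -> R)
  (hq : orthonormal_basis (cuboid xL xR yL yR zL zR) q)
  (eta1 eta2 : nat -> R) (beta1 beta2 : nat -> R -> {RV P >-> R})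
  (hbeta : independent_brownian_motions
     (fun l : nat + nat =>
        match l with inl m => beta1 m | inr m => beta2 m end))
  (W1 W2 : R -> (R * R * R)%type -> Omega -> R)
  (hW1 : Q_Wiener_process (cuboid xL xR yL yR zL zR) q eta1 beta1 W1)
  (hW2 : Q_Wiener_process (cuboid xL xR yL yR zL zR) q eta2 beta2 W2)
  (b : R) (hb : 4 <= b)
  (* numerical solution, as a function of the initial data theta in V *)
  (V : normedModType R) (u0 : grid (V -> 'cV[R]_(3 + 3)))
  (u : Omega -> nat -> grid (V -> 'cV[R]_(3 + 3)))
  (hu0 : forall w i j k, (i <= Nx)%N -> (j <= Ny)%N -> (k <= Nz)%N ->
     u w 0%N i j k = u0 i j k)
  (hudiff : {ae P, forall w, forall n i j k,
     (i <= Nx)%N -> (j <= Ny)%N -> (k <= Nz)%N ->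
     forall theta, differentiable (u w n i j k) theta})
  (hscheme : {ae P, forall w, forall n i j k,
     (i < Nx)%N -> (j < Ny)%N -> (k < Nz)%N -> forall theta,
     scheme_equation dt dx dy dz lambda1 lambda2
       (sigma (node xL yL zL dx dy dz i j k))
       (truncated_wiener_increment b q eta1 beta1 dt n
          (cell_center xL yL zL dx dy dz i j k) w / dt)
       (wiener_increment W2 dt n (cell_center xL yL zL dx dy dz i j k) w / dt)
       (fun m i' j' k' => u w m i' j' k' theta) n i j k}) :
  forall n i j k, (i < Nx)%N -> (j < Ny)%N -> (k < Nz)%N ->
  {ae P, forall w,
     conformal_multisymplectic_law dt dx dy dz
       (sigma (node xL yL zL dx dy dz i j k)) (u w) n i j k}.
Proof.
move=> n i j k iN jN kN.
(* On the intersection of the two almost sure events the sample [w] is fixed, and the noises become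
   plain numbers. *)
apply: filterS2 hudiff hscheme => w udiff scheme.
rewrite /conformal_multisymplectic_law.
apply/funext => theta; apply/funext => v1; apply/funext => v2.
have corner (t e1 e2 e3 : bool) :
    is_diff theta (u w (t + n)%N (e1 + i)%N (e2 + j)%N (e3 + k)%N)
      ('d (u w (t + n)%N (e1 + i)%N (e2 + j)%N (e3 + k)%N) theta).
  (* From [i < Nx] both [i] and [i + 1] are at most [Nx], so every corner is a mesh node; likewise
     in y and z. *)
  by apply/differentiableP/udiff; [case: e1|case: e2|case: e3] => //; exact: ltnW.
apply: (@conformal_law_at _ _ _ _ _ _ _ _ _
  (fun m i' j' k' => 'd (u w m i' j' k') theta) _ _ _ _ corner).
(* This fixes [mu] as [lambda1] times the truncated noise value of the cell. *)
exact: linearized_scheme corner _ _ _ _ (fun x => scheme n i j k iN jN kN x).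
Qed.
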